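(* Let $(\Gamma,h)$ be a 3-valent immersive tropical curve in $N_{\mathbb R}\cong\mathbb R^n$. Then the number of parameters to deform it (the dimension of the parameter space of tropical curves of its combinatorial type) is given by $(n-3)(1-g)+e+\dim_{\mathbb C}H$, where $g$ is the genus of $\Gamma$, $e$ is the number of unbounded edges of $\Gamma$, and $H$ is the dual obstruction space described in the context.
   Context: $N$ is a free abelian group of rank $n$, $N_K=N\otimes_{\mathbb Z}K$, and $U^\perp\subset N_{\mathbb C}^\vee$ denotes the annihilator of $U\subset N_{\mathbb C}$. $\Gamma$ is the complement of the set of 1-valent vertices in a connected finite graph with positive integer edge weights $w(E)$; its non-compact edges are unbounded. An immersive tropical curve is a proper continuous map $h\colon\Gamma\to N_{\mathbb R}$ embedding every edge in an affine line of rational slope, mapping vertices into $N_{\mathbb Q}$, and satisfying at every vertex the balancing condition $\sum_jw(E_j)u_j=0$, the sum over edges $E_j$ at the vertex, $u_j\in N$ being the primitive integral direction of $h(E_j)$ pointing away from the vertex. Different edges may have the same image. 3-valent: every vertex of $\Gamma$ is 3-valent (2-valent vertices are neglected). The genus is the first Betti number of $\Gamma$. The combinatorial type is $\Gamma$ (with weights) together with the direction vectors of its flags $(v,E)$; the parameter space of the type is the (convex polyhedral) space of immersive tropical curves of this type, allowing real vertex positions, and its dimension is taken as a real polyhedral domain. An edge is part of a loop if removing its interior lowers the first Betti number of $\Gamma$; the loop part $L$ is the union of all such edges. Cut $L$ at each 3-valent vertex of $L$ to obtain piecewise linear segments $\{l_m\}$, and let $U_m\subset N_{\mathbb C}$ be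 spanned by the direction vectors of the segments of $l_m$. $H$ is the complex vector space of all assignments of vectors of $N_{\mathbb C}^\vee$ to the flags of $\Gamma$ such that: flags not contained in $L$ get the value $0$; flags of edges of $l_m$ get values in $U_m^\perp$; at each vertex the sum of the values of its three flags is $0$; and for every edge of $l_m$ the sum of the values of its two flags is $0$. (When a pre-log curve $\varphi_0\colon C_0\to X_0$ of type $(\Gamma,h)$ exists, $H$ is $H^1(C_0,\varphi_0^*\Theta_{\mathfrak X/\mathbb C}/\Theta_{C_0/O_0})^\vee$, but the combinatorial space makes sense, and the formula is meant, without such a curve.) *)

(* Defs.v *)
From mathcomp Require Import all_boot all_order all_algebra.
From mathcomp Require Import boolp classical_sets reals.
From mathcomp Require Import complex.

Set Implicit Arguments.
Unset Strict Implicit.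
Unset Printing Implicit Defensive.

Import Order.TTheory GRing.Theory Num.Theory.
Local Open Scope ring_scope.

Section Span.
Context {K : fieldType} {V : vectType K}.
Implicit Types (S : set V) (W : {vspace V}).

Lemma set_span_exists S :
  exists W, (forall v, S v -> v \in W) /\
    (forall W', (forall v, S v -> v \in W') -> (W <= W')%VS).
Proof.
pose P d := `[< exists W, \dim W = d /\ forall v, S v -> v \in W >].
have exP : exists d, P d.
  by exists (\dim (fullv : {vspace V})); apply/asboolP; exists fullv; split=> // v _; rewrite memvf.
case: (ex_minnP exP) => d /asboolP [W [dW SW]] mind.
exists W; split=> // W' SW'.
have SI : forall v, S v -> v \in (W :&: W')%VS.
  by move=> v Sv; rewrite memv_cap SW // SW'.
have : (d <= \dim (W :&: W')%VS)%N by apply: mind; apply/asboolP; eexists.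
rewrite -dW => led; apply/capv_idPl/eqP.
by rewrite eqEdim capvSl led.
Qed.

Definition set_span S : {vspace V} := sval (cid (set_span_exists S)).

Lemma sub_set_span S v : S v -> v \in set_span S.
Proof. by rewrite /set_span; case: cid => W [] /= + _; apply. Qed.

Lemma set_span_min S W : (forall v, S v -> v \in W) -> (set_span S <= W)%VS.
Proof. by rewrite /set_span; case: cid => U [] /= _; apply. Qed.

Lemma set_span_subspace S : S 0 ->
  (forall a u v, S u -> S v -> S (a *: u + v)) ->
  forall v, v \in set_span S <-> S v.
Proof.
move=> S0 Slin v; split; last exact: sub_set_span.
pose P d := `[< exists W, \dim W = d /\ forall v, v \in W -> S v >].
have exP : exists d, P d.
  exists 0%N; apply/asboolP; exists 0%VS; split; first exact: dimv0.
  by move=> u; rewrite memv0 => /eqP ->.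
have bP d : P d -> (d <= \dim (fullv : {vspace V}))%N.
  by move=> /asboolP [W [<- _]]; rewrite dimvS ?subvf.
case: (ex_maxnP exP bP) => d /asboolP [W [dW WS]] maxd.
suff /set_span_min/subvP sW : forall v, S v -> v \in W by move=> /sW /WS.
move=> u Su.
have WuS : forall x, x \in (W + <[u]>)%VS -> S x.
  move=> x /memv_addP [w wW [y /vlineP [a ->] ->]].
  by rewrite addrC; apply: Slin => //; apply: WS.
have : (\dim (W + <[u]>)%VS <= d)%N by apply: maxd; apply/asboolP; eexists.
rewrite -dW => led.
have /eqP -> : W == (W + <[u]>)%VS by rewrite eqEdim addvSl led.
by apply: (subvP (addvSr W _)); exact: memv_line.
Qed.

(* The dimension of the affine hull of a nonempty S, i.e. of its space of
   translations (and 0 for the empty set). *)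
Definition affine_dim S : nat :=
  \dim (set_span [set z | exists x y, [/\ S x, S y & z = x - y]]%classic).

End Span.

(* Loops and multiple edges are allowed; each edge E carries an arbitrary
   orientation, from [gend E false] to [gend E true]. This is the compact graph;
   the graph Gamma proper is obtained by deleting its 1-valent vertices. *)
Record weighted_graph := WeightedGraph {
  gvert : finType;
  gedge : finType;
  gend : gedge -> bool -> gvert;
  weight : gedge -> nat;
  weight_gt0 : forall E, (0 < weight E)%N;
  gconnected : forall v v' : gvert,
    connect (fun a b => [exists E, exists s,
      (gend E s == a) && (gend E (~~ s) == b)]) v v'
}.

Section Graph.
Variable G : weighted_graph.

Definition valence (v : gvert G) : nat :=
  #|[set x : gedge G * bool | gend x.1 x.2 == v]|.

Definition leaf (v : gvert G) : bool := valence v == 1%N.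

Definition vertex := {v : gvert G | ~~ leaf v}.

Definition unbounded (E : gedge G) : bool := [exists s, leaf (gend E s)].

Definition num_unbounded : nat := #|[set E | unbounded E]|.

(* A vertex of Gamma together with an edge germ at it. *)
Definition flag := {x : gedge G * bool | ~~ leaf (gend x.1 x.2)}.

Definition fedge (x : flag) : gedge G := (val x).1.
Definition fvertex (x : flag) : vertex :=
  exist _ (gend (val x).1 (val x).2) (valP x).

(* The existence of a vertex excludes the graph whose only edge joins two
   1-valent vertices, i.e. the case where Gamma is a bare line. *)
Definition trivalent : Prop :=
  (0 < #|{: vertex}|)%N /\ forall v : vertex, valence (val v) = 3%N.

(* Cellular 1-cycles, with rational coefficients, of the subgraph with edge
   set A. Deleting 1-valent vertices is a homotopy equivalence, so the compact
   graph may be used to compute the Betti numbers of Gamma. *)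
Definition is_cycle (A : {set gedge G}) (c : {ffun gedge G -> rat^o}) : Prop :=
  (forall E, E \notin A -> c E = 0) /\
  (forall v, \sum_(E | gend E true == v) c E
             - \sum_(E | gend E false == v) c E = 0).

Definition betti1 (A : {set gedge G}) : nat := \dim (set_span (is_cycle A)).

Lemma cycle_spaceP A c : c \in set_span (is_cycle A) <-> is_cycle A c.
Proof.
apply: set_span_subspace.
  by split=> [E _|v]; [rewrite ffunE | rewrite !big1 ?subr0 // => E _; rewrite ffunE].
move=> a u v [u1 u2] [v1 v2]; split=> [E EA|x].
  by rewrite !ffunE u1 // v1 // scaler0 addr0.
have lin b : \sum_(E | gend E b == x) (a *: u + v) E =
   a *: (\sum_(E | gend E b == x) u E) + \sum_(E | gend E b == x) v E.
  rewrite scaler_sumr -big_split /=.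
  by apply: eq_bigr => E _; rewrite !ffunE.
by rewrite !lin opprD addrACA -scalerBr u2 v2 scaler0 addr0.
Qed.

Definition genus : nat := betti1 [set: gedge G].

Definition loop_edge (E : gedge G) : bool := (betti1 [set~ E] < genus)%N.

Definition loop_valence (v : vertex) : nat :=
  #|[set x : flag | (fvertex x == v) && loop_edge (fedge x)]|.

(* The loop part is cut exactly at the vertices with three flags in it, so
   loop edges meeting at any other vertex stay in the same segment l_m. *)
Definition uncut (E E' : gedge G) : bool :=
  [exists x : flag, exists y : flag,
    [&& fedge x == E, fedge y == E', loop_edge E, loop_edge E',
        fvertex x == fvertex y & loop_valence (fvertex x) != 3%N]].

Definition same_segment : rel (gedge G) := connect uncut.

End Graph.

(* N is Z^n and N_K is K^n, as row vectors; the dual space N_K^vee is K^n as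
   column vectors, a covector xi sending u to u *m xi. *)
Definition base_change (K : pzRingType) n (u : 'rV[int]_n) : 'rV[K]_n :=
  map_mx intr u.

Definition primitive n (u : 'rV[int]_n) : Prop :=
  forall (k : nat) (v : 'rV[int]_n), u = v *+ k -> k = 1%N.

(* The vertex positions p send each bounded edge homeomorphically onto a
   nondegenerate segment which leaves each end in the direction of that flag. *)
Definition realizes (G : weighted_graph) n (K : realFieldType)
    (u : flag G -> 'rV[int]_n) (p : {ffun vertex G -> 'rV[K]_n}) : Prop :=
  forall x y : flag G, fedge x = fedge y -> x != y ->
    exists2 l : K, 0 < l & p (fvertex y) - p (fvertex x) = l *: base_change K (u x).

(* The map h up to reparametrization of the edges: a bounded edge goes to the
   segment joining the positions of its ends, an unbounded edge, whose only flag
   is x, to the ray from position (fvertex x) in direction (direction x). *)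
Record immersive_tropical_curve (G : weighted_graph) (n : nat) :=
    ImmersiveTropicalCurve {
  position : {ffun vertex G -> 'rV[rat]_n};
  direction : flag G -> 'rV[int]_n;
  direction_primitive : forall x, primitive (direction x);
  position_realizes : realizes direction position;
  balanced : forall v : vertex G,
    \sum_(x | fvertex x == v) direction x *+ weight (fedge x) = 0
}.

Section Curve.
Variables (R : realType) (n : nat) (G : weighted_graph).
Variable h : immersive_tropical_curve G n.

(* The real curves with the same weighted graph and the same flag directions;
   balancing and primitivity only depend on those data. *)
Definition parameter_space : set {ffun vertex G -> 'rV[R]_n} :=
  [set p | realizes (direction h) p]%classic.

(* U_m, for the segment l_m containing E. *)
Definition segment_span (E : gedge G) : {vspace 'rV[R[i]]_n} :=
  <<[seq base_change R[i] (direction h x)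
      | x : flag G in [pred x | same_segment E (fedge x)]]>>%VS.

Definition annihilates (U : {vspace 'rV[R[i]]_n}) (xi : 'cV[R[i]]_n) : Prop :=
  forall u, u \in U -> u *m xi = 0.

Definition dual_obstruction (f : {ffun flag G -> 'cV[R[i]]_n}) : Prop :=
  [/\ forall x, ~~ loop_edge (fedge x) -> f x = 0,
      forall x, loop_edge (fedge x) -> annihilates (segment_span (fedge x)) (f x),
      forall v, \sum_(x | fvertex x == v) f x = 0
    & forall E, loop_edge E -> \sum_(x | fedge x == E) f x = 0].

Definition dual_obstruction_space : {vspace {ffun flag G -> 'cV[R[i]]_n}} :=
  set_span dual_obstruction.

Lemma dual_obstruction_spaceP f :
  f \in dual_obstruction_space <-> dual_obstruction f.
Proof.
apply: set_span_subspace.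
  split=> [x _|x _ u _|v|E _]; rewrite ?ffunE ?mulmx0 // big1 // => x _;
  by rewrite ffunE.
have lin a (u v : {ffun flag G -> 'cV[R[i]]_n}) (P : pred (flag G)) :
    \sum_(x | P x) (a *: u + v) x = a *: (\sum_(x | P x) u x) + \sum_(x | P x) v x.
  by rewrite scaler_sumr -big_split /=; apply: eq_bigr => x _; rewrite !ffunE.
move=> a u v [u1 u2 u3 u4] [v1 v2 v3 v4]; split=> [x Lx|x Lx w wU|x|E LE].
- by rewrite !ffunE u1 // v1 // scaler0 addr0.
- by rewrite !ffunE mulmxDr -scalemxAr u2 // v2 // scaler0 addr0.
- by rewrite lin u3 v3 scaler0 addr0.
- by rewrite lin u4 // v4 // scaler0 addr0.
Qed.

End Curve.

Arguments parameter_space R {n G} h.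
Arguments dual_obstruction_space R {n G} h.

(* Main.v *)
From HB Require Import structures.
Require Import Defs.
From mathcomp Require Import all_boot all_order all_algebra.
From mathcomp Require Import reals.
From mathcomp Require Import complex.
From mathcomp Require Import zify ring lra.

(* Deformations of the curve and dual obstructions are the kernels of one
   rational incidence matrix and of its transpose, so their dimensions differ by
   the difference of the numbers of columns and rows, whatever the base fields;
   counting vertices, edges and flags of a 3-valent graph turns this difference
   into (n-3)(1-g)+e. The left kernel consists of the translations of the
   parameter space, because adding a large multiple of the given curve makes all
   edge lengths positive. In the right kernel a covector-valued flow is only
   required to annihilate the direction of each edge; it vanishes off the loop
   part, as all cycles do, and so is constant up to sign along each segment l_m,
   hence annihilates all of U_m. *)

Set Implicit Arguments.
Unset Strict Implicit.
Unset Printing Implicit Defensive.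

Import Order.TTheory GRing.Theory Num.Theory.
Local Open Scope ring_scope.

(** * Linear algebra: rational systems solved over varying fields *)

Lemma sum_delta (K : pzRingType) (I : finType) (i0 : I) (x : I -> K) :
  \sum_i (i == i0)%:R * x i = x i0.
Proof.
rewrite (bigD1 i0) //= eqxx mul1r big1 ?addr0 // => i /negPf ->.
by rewrite mul0r.
Qed.

Lemma dim_bijective_image (K : fieldType) (V V' : vectType K) (f : V -> V')
    (U : {vspace V}) (U' : {vspace V'}) :
  linear f -> (forall x, x \in U -> f x = 0 -> x = 0) ->
  (forall x, x \in U -> f x \in U') ->
  (forall y, y \in U' -> exists2 x, x \in U & f x = y) ->
  \dim U' = \dim U.
Proof.
move=> f_lin f_inj fU fU'.
pose fL := GRing.isLinear.Build _ _ _ _ f f_lin.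
pose F : {linear V -> V'} := HB.pack f fL.
have -> : U' = (linfun F @: U)%VS.
  apply/vspaceP => y; apply/idP/idP => [/fU' [x xU <-] | /memv_imgP [x xU ->]].
    by apply/memv_imgP; exists x => //; rewrite lfunE.
  by rewrite lfunE /= fU.
rewrite limg_dim_eq //; apply/eqP; rewrite -subv0; apply/subvP => x.
rewrite memv_cap memv_ker lfunE /= memv0 => /andP [xU /eqP fx0].
by apply/eqP; apply: f_inj.
Qed.

Section LinearSystem.
Variables (I J : finType) (a : I -> J -> rat).

(** The left kernel of [a], read in [K]. Keeping the coefficients rational is what allows kernels
    over different fields to be compared. *)
Definition solutions (K : numFieldType) : {vspace {ffun I -> K^o}} :=
  set_span (fun x : {ffun I -> K^o} => forall j,
    \sum_i ratr (a i j) * x i = 0 :> K).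

Lemma solutionsP (K : numFieldType) (x : {ffun I -> K^o}) :
  x \in solutions K <-> forall j, \sum_i ratr (a i j) * x i = 0 :> K.
Proof.
apply: set_span_subspace => [j|b u v hu hv j].
  by rewrite big1 // => i _; rewrite ffunE mulr0.
transitivity (b * (\sum_i ratr (a i j) * u i) + \sum_i ratr (a i j) * v i : K);
  last by rewrite hu hv mulr0 addr0.
rewrite mulr_sumr -big_split; apply: eq_bigr => i _.
by rewrite !ffunE mulrDr mulrCA.
Qed.

Definition coef_mx : 'M[rat]_(#|I|, #|J|) :=
  \matrix_(i, j) a (enum_val i) (enum_val j).

(** Rank-nullity, together with the invariance of the rank of a rational matrix under extension of
    the base field. *)
Lemma dim_solutions (K : numFieldType) :
  (\dim (solutions K) + \rank coef_mx)%N = #|I|.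
Proof.
pose A : 'M[K]_(#|I|, #|J|) := map_mx ratr coef_mx.
have rA : \rank A = \rank coef_mx by rewrite mxrank_map.
(* The rows of [B] form a basis of the kernel, so [psi] sends coordinates in that basis bijectively
   to solutions, indexed by [I] through its enumeration. *)
pose B := row_base (kermx A).
pose psi (u : 'rV[K]_(\rank (kermx A))) : {ffun I -> K^o} :=
  [ffun i => (u *m B) 0 (enum_rank i)].
have psi_lin : linear psi.
  by move=> b u v; apply/ffunP => i; rewrite !ffunE mulmxDl -scalemxAl !mxE.
have psi_inj : injective psi.
  move=> u v /ffunP e; apply: (row_free_inj (row_base_free (kermx A))).
  apply/rowP => i; move: (e (enum_val i)).
  by rewrite !ffunE enum_valK.
have eM (z : 'rV[K]_#|I|) j : (z *m A) 0 (enum_rank j) =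
    \sum_i ratr (a i j) * [ffun i => z 0 (enum_rank i)] i.
  rewrite mxE (reindex enum_rank) /=; last by apply: onW_bij; exact: enum_rank_bij.
  by apply: eq_bigr => i _; rewrite !mxE !ffunE !enum_rankK mulrC.
have eS (z : 'rV[K]_#|I|) : (z <= kermx A)%MS <->
    [ffun i => z 0 (enum_rank i)] \in solutions K.
  rewrite solutionsP; split=> [/sub_kermxP zA j|h].
    by rewrite -eM zA mxE.
  apply/sub_kermxP/rowP => j.
  by rewrite -(enum_valK j) [LHS]eM h mxE.
rewrite (dim_bijective_image (f := psi) (U := fullv)) //.
- by rewrite dimvf /dim /= mul1n mxrank_ker rA subnK // rank_leq_row.
- move=> u _ e; apply: psi_inj; rewrite e; apply/ffunP => i.
  by rewrite !ffunE mul0mx mxE.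
- move=> u _; apply/eS.
  by apply: (submx_trans (submxMl _ _)); rewrite eq_row_base.
- move=> x xS; have := eS (\row_i x (enum_val i)).
  have -> : [ffun i => (\row_i0 x (enum_val i0)) 0 (enum_rank i)] = x.
    by apply/ffunP => i; rewrite !ffunE mxE enum_rankK.
  case=> _ /(_ xS); rewrite -(eq_row_base (kermx A)) => /submxP [u eu].
  exists u; first exact: memvf.
  by apply/ffunP => i; rewrite !ffunE /B -eu mxE enum_rankK.
Qed.

End LinearSystem.

(** A matrix and its transpose have the same rank. The two fields may differ because deformations
    live over the reals and obstructions over the complex numbers. *)
Lemma dim_solutions_tr (I J : finType) (a : I -> J -> rat) (K K' : numFieldType) :
  (\dim (solutions a K) + #|J| = \dim (solutions (fun j i => a i j) K') + #|I|)%N.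
Proof.
have e : coef_mx (fun j i => a i j) = (coef_mx a)^T.
  by apply/matrixP => i j; rewrite !mxE.
move: (dim_solutions a K) (dim_solutions (fun j i => a i j) K').
by rewrite e mxrank_tr; lia.
Qed.

Lemma dim_solutions_field (I J : finType) (a : I -> J -> rat) (K K' : numFieldType) :
  \dim (solutions a K) = \dim (solutions a K').
Proof.
by apply/eqP; rewrite -(eqn_add2r (\rank (coef_mx a))) !dim_solutions.
Qed.

(** * Cycles, Euler characteristic and counting in the graph *)

Section Graph.
Variable G : weighted_graph.

Definition boundary (E : gedge G) (v : gvert G) : rat :=
  (gend E true == v)%:R - (gend E false == v)%:R.

Lemma sum_boundary (K : numFieldType) (c : gedge G -> K) (v : gvert G) :
  \sum_E ratr (boundary E v) * c E =
  \sum_(E | gend E true == v) c E - \sum_(E | gend E false == v) c E.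
Proof.
rewrite [X in _ = X - _]big_mkcond [X in _ - X]big_mkcond -sumrB; apply: eq_bigr => E _.
rewrite /boundary rmorphB /= !ratr_nat mulrBl.
by do 2 case: (_ == v); rewrite ?mul1r ?mul0r.
Qed.

Lemma genus_solutions : genus G = \dim (solutions boundary rat).
Proof.
congr (\dim _); apply/vspaceP => c; apply/idP/idP.
  move/cycle_spaceP => [_ cv]; apply/solutionsP => v.
  by rewrite sum_boundary cv.
move/solutionsP => cv; apply/cycle_spaceP; split=> [E|v]; first by rewrite inE.
by rewrite -sum_boundary cv.
Qed.

(* The column None forces a cycle to vanish at E0. *)
Definition pinned_boundary (E0 E : gedge G) (j : option (gvert G)) : rat :=
  if j is Some v then boundary E v else (E == E0)%:R.

Lemma pinned_solutionsP (K : numFieldType) E0 (c : {ffun gedge G -> K^o}) :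
  c \in solutions (pinned_boundary E0) K <-> c \in solutions boundary K /\ c E0 = 0.
Proof.
have e : \sum_E ratr (pinned_boundary E0 E None) * c E = c E0 :> K.
  rewrite -[RHS](sum_delta E0 (c : _ -> K)); apply: eq_bigr => E _.
  by rewrite /= ratr_nat.
split=> [/solutionsP h | [/solutionsP h c0]].
  by split; [apply/solutionsP => v; exact: (h (Some v)) | rewrite -e h].
by apply/solutionsP => -[v|]; [exact: h | rewrite e].
Qed.

Lemma betti1_pinned (E0 : gedge G) :
  betti1 [set~ E0] = \dim (solutions (pinned_boundary E0) rat).
Proof.
congr (\dim _); apply/vspaceP => c; apply/idP/idP.
  move/cycle_spaceP => [c0 cv]; apply/pinned_solutionsP; split.
    by apply/solutionsP => v; rewrite sum_boundary cv.
  by rewrite c0 // !inE eqxx.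
move/pinned_solutionsP => [/solutionsP cv c0].
apply/cycle_spaceP; split=> [E|v]; last by rewrite -sum_boundary cv.
by rewrite !inE negbK => /eqP ->.
Qed.

(** The cycles vanishing at [E] form a subspace of all cycles. If [E] is not a loop edge, the two
    have the same dimension over the rationals, hence over [K], and so they coincide. *)
Lemma solutions_nonloop (K : numFieldType) E (c : {ffun gedge G -> K^o}) :
  ~~ loop_edge E -> c \in solutions boundary K -> c E = 0.
Proof.
rewrite /loop_edge -leqNgt betti1_pinned genus_solutions.
rewrite (dim_solutions_field _ rat K) (dim_solutions_field (pinned_boundary E) rat K).
move=> le_dim cS.
have sub : (solutions (pinned_boundary E) K <= solutions boundary K)%VS.
  by apply/subvP => x /pinned_solutionsP [].
have /eqP eqS : solutions (pinned_boundary E) K == solutions boundary K.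
  by rewrite eqEdim sub.
by move: cS; rewrite -eqS => /pinned_solutionsP [].
Qed.

Lemma adjacent_const (T : Type) (p : gvert G -> T) :
  (forall E, p (gend E true) = p (gend E false)) -> forall v w, p v = p w.
Proof.
move=> pE v w; have /connectP [s + ->] := gconnected v w.
elim: s v => //= a s IH v /andP [/existsP [E /existsP [b]]].
case/andP => /eqP <- /eqP <- /IH <-.
by case: b => /=; rewrite pE.
Qed.

(** The transposed kernel of the boundary matrix consists of the functions on vertices that agree at
    both ends of each edge. By connectedness these are the constants, of dimension 1 since [v0]
    exists. *)
Lemma euler_characteristic (v0 : gvert G) :
  (genus G + #|gvert G| = #|gedge G| + 1)%N.
Proof.
rewrite genus_solutions (dim_solutions_tr boundary rat rat).
rewrite (dim_bijective_image (f := fun c : rat^o => [ffun _ => c] : {ffun gvert G -> rat^o})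
  (U := fullv)).
- by rewrite dimvf addnC.
- by move=> b u v; apply/ffunP => i; rewrite !ffunE.
- by move=> x _ /ffunP /(_ v0); rewrite !ffunE.
- move=> x _; apply/solutionsP => E.
  under eq_bigr do rewrite ffunE.
  rewrite -mulr_suml -rmorph_sum /boundary sumrB /=.
  have one b : \sum_v (gend E b == v)%:R = 1 :> rat.
    rewrite -[RHS](sum_delta (gend E b) (fun=> 1)).
    by apply: eq_bigr => w _; rewrite mulr1 eq_sym.
  by rewrite !one subrr rmorph0 mul0r.
- move=> p /solutionsP h; exists (p v0); first exact: memvf.
  apply/ffunP => v; rewrite ffunE; apply: (@adjacent_const rat p) => E.
  apply/eqP; rewrite -subr_eq0 -[X in _ == X](h E); apply/eqP.
  rewrite -[X in X - _](sum_delta (gend E true) (p : _ -> rat)).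
  rewrite -[X in _ - X](sum_delta (gend E false) (p : _ -> rat)) -sumrB.
  apply: eq_bigr => w _; rewrite /boundary rmorphB /= !ratr_nat mulrBl.
  by rewrite ![_ == w]eq_sym.
Qed.

Lemma valence_sum (P : pred (gvert G)) :
  #|[set x : gedge G * bool | P (gend x.1 x.2)]| = (\sum_(v | P v) valence v)%N.
Proof.
rewrite -sum1_card (partition_big (fun x => gend x.1 x.2) P) => [|x]; last by rewrite inE.
apply: eq_bigr => v Pv; rewrite /valence -sum1_card; apply: eq_bigl => x.
by rewrite !inE; case: eqP => [->|]; rewrite ?Pv ?andbF.
Qed.

Lemma leaf_half_edge (x y : gedge G * bool) :
  leaf (gend x.1 x.2) -> gend y.1 y.2 = gend x.1 x.2 -> y = x.
Proof.
move=> /cards1P [z ez] e.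
have hz w : gend w.1 w.2 = gend x.1 x.2 -> w = z.
  by move=> ew; apply/set1P; rewrite -ez inE ew.
by rewrite (hz _ e) (hz x).
Qed.

(** An edge with two leaf ends meets no other edge, so by connectedness it would be the whole graph,
    leaving no room for [v0]. *)
Lemma unbounded_one_leaf (v0 : vertex G) (E : gedge G) s :
  leaf (gend E s) -> ~~ leaf (gend E (~~ s)).
Proof.
move=> Ls; apply/negP => Lns.
have Lb b : leaf (gend E b) by case: s b Ls Lns => -[].
(* A walk starting at an end of [E] never leaves the ends of [E]. *)
have inv v w : connect (fun a b => [exists E, exists s,
    (gend E s == a) && (gend E (~~ s) == b)]) v w ->
    (exists b, gend E b = v) -> exists b, gend E b = w.
  case/connectP=> p + ->; elim: p v => //= a p IH v /andP [va ap] [b eb].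
  apply: IH ap _; move: va => /existsP [E' /existsP [s' /andP [/eqP e1 /eqP <-]]].
  have [-> ->] := @leaf_half_edge (E, b) (E', s') (Lb b) (etrans e1 (esym eb)).
  by exists (~~ b).
have [] := inv (gend E s) (val v0) (gconnected _ _); first by exists s.
by move=> b eb; move: (valP v0); rewrite -eb Lb.
Qed.

(** Both sides count the half-edges at leaves: a leaf has exactly one, and an unbounded edge has
    exactly one leaf end. *)
Lemma card_leaves (v0 : vertex G) : #|[set v : gvert G | leaf v]| = num_unbounded G.
Proof.
pose X := [set x : gedge G * bool | leaf (gend x.1 x.2)].
have -> : num_unbounded G = #|X|.
  rewrite -(card_in_imset (f := fst)) => [|[E s] [E' s']].
    apply: eq_card => E; rewrite inE; apply/existsP/imsetP => [[s Ls]|[[E' s] Ls ->]].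
      by exists (E, s); rewrite ?inE.
    by exists s; rewrite inE in Ls.
  rewrite !inE /= => L L' EE; subst E'; congr pair.
  apply/eqP/negPn/negP => ne; move: (unbounded_one_leaf v0 L).
  by rewrite (_ : ~~ s = s') ?L' //; case: s s' ne {L L'} => -[].
rewrite /X valence_sum -sum1_card big_mkcond [RHS]big_mkcond.
by apply: eq_bigr => v _; rewrite inE /leaf; case: eqP => [->|].
Qed.

Lemma card_flags : trivalent G -> #|{: flag G}| = (3 * #|{: vertex G}|)%N.
Proof.
case=> _ val3.
rewrite card_sig -[LHS](_ : #|[set x : gedge G * bool | ~~ leaf (gend x.1 x.2)]| = _);
  last by rewrite cardsE.
rewrite (valence_sum (fun v => ~~ leaf v)).
rewrite (eq_bigr (fun=> 3%N)) => [|v nL]; last exact: (val3 (exist _ v nL)).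
by rewrite sum_nat_const mulnC card_sig.
Qed.

Lemma card_half_edges (v0 : vertex G) :
  (2 * #|gedge G| = #|{: flag G}| + num_unbounded G)%N.
Proof.
have -> : (2 * #|gedge G| = #|{: gedge G * bool}|)%N by rewrite card_prod card_bool mulnC.
rewrite -[LHS](cardID [pred x | leaf (gend x.1 x.2)]) addnC; congr addn.
  by rewrite card_sig; apply: eq_card => x; rewrite !inE andbT.
rewrite -(card_leaves v0).
transitivity #|[set x : gedge G * bool | leaf (gend x.1 x.2)]|.
  by apply: eq_card => x; rewrite !inE.
rewrite valence_sum -sum1_card big_mkcond [RHS]big_mkcond.
by apply: eq_bigr => v _; rewrite inE /leaf; case: eqP => [->|].
Qed.

Lemma card_vertices (v0 : vertex G) :
  #|gvert G| = (#|{: vertex G}| + num_unbounded G)%N.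
Proof.
rewrite -(card_leaves v0) -[LHS](cardID [pred v : gvert G | leaf v]) addnC; congr addn.
  by rewrite card_sig; apply: eq_card => x; rewrite !inE andbT.
by apply: eq_card => x; rewrite !inE.
Qed.

Definition bounded_edge := {E : gedge G | ~~ unbounded E}.

Lemma card_edges : #|gedge G| = (#|{: bounded_edge}| + num_unbounded G)%N.
Proof.
rewrite -[LHS](cardID (@unbounded G)) addnC; congr addn.
  by rewrite card_sig; apply: eq_card => x; rewrite !inE andbT.
by rewrite /num_unbounded; apply: eq_card => x; rewrite !inE.
Qed.

End Graph.

(** * Flags and flows on them *)

Section Flags.
Variable G : weighted_graph.

Lemma bounded_not_leaf (E : bounded_edge G) s : ~~ leaf (gend (val E) s).
Proof. by have /existsPn := valP E; apply. Qed.

Definition bounded_flag (E : bounded_edge G) (s : bool) : flag G :=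
  exist _ (val E, s) (bounded_not_leaf E s).

Lemma edge_flagsP (x y : flag G) : fedge x = fedge y -> x != y ->
  exists (E : bounded_edge G) (s : bool),
    x = bounded_flag E s /\ y = bounded_flag E (~~ s).
Proof.
case: x y => [[E s] nL] [[E' s'] nL'] /= e ne.
rewrite /fedge /= in e; subst E'.
have ns : s' = ~~ s.
  by move: ne; rewrite -val_eqE /= xpair_eqE eqxx; case: s s' {nL nL'} => -[].
subst s'; have bE : ~~ unbounded E.
  by apply/existsPn => b; case: b s nL nL' {ne} => -[].
by exists (exist _ E bE), s; split; apply: val_inj.
Qed.

Lemma edge_flags_opp (V : zmodType) (f : flag G -> V) (x y : flag G) :
  \sum_(z | fedge z == fedge x) f z = 0 -> fedge x = fedge y -> x != y ->
  f y = - f x.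
Proof.
move=> + e ne; rewrite (bigD1 x) //= (bigD1 y) /=; last by rewrite e eqxx eq_sym.
rewrite big1 ?addr0 => [/eqP|z /andP [/andP [/eqP ez zx] zy]].
  by rewrite addrC addr_eq0 => /eqP.
have [E [s [ex ey]]] := edge_flagsP e ne.
have [E' [s' [ez' ex']]] := edge_flagsP ez zx.
move: zy; rewrite ey ez'; suff [-> ->] : E' = E /\ s' = ~~ s by rewrite eqxx.
move: ex'; rewrite ex => /(congr1 val) /= [eE ->]; rewrite negbK; split=> //.
exact/val_inj.
Qed.

Lemma card_flags_at (v : vertex G) :
  #|[set x : flag G | fvertex x == v]| = valence (val v).
Proof.
rewrite -(card_imset _ val_inj); apply: eq_card => y; rewrite inE.
apply/imsetP/eqP => [[x] | e].
  by rewrite inE => /eqP <- ->.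
have nL : ~~ leaf (gend y.1 y.2) by rewrite e (valP v).
exists (exist _ y nL) => //; rewrite inE; apply/eqP/val_inj; exact: e.
Qed.

(** Extending [f] by 0 to the half-edges at leaves turns sums over flags into sums over half-edges
    of the compact graph, where cycles are defined. *)
Lemma sum_half_edges (V : nmodType) (P : pred (gedge G * bool)) (f : flag G -> V) :
  \sum_(y | P y) oapp f 0 (insub y) = \sum_(x | P (val x)) f x.
Proof.
rewrite (bigID (fun y => ~~ leaf (gend y.1 y.2))) /= [X in _ + X]big1 ?addr0.
  rewrite (reindex_omap (fun x : flag G => val x) (fun y => insub y)) /=;
    last by move=> y /andP [_ nL]; rewrite insubT.
  by apply: eq_big => [x|x _]; rewrite valK ?eqxx ?andbT ?(valP x) ?andbT.
by move=> y /andP [_ /negbNE L]; rewrite insubF // L.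
Qed.

(** Extended by 0 at leaves, [f] takes opposite values on the two halves of each edge, so its values
    on the [true] halves form a cycle of the compact graph. Cycles vanish off the loop part. *)
Lemma flow_nonloop (K : numFieldType) (f : flag G -> K) :
  (forall v, \sum_(x | fvertex x == v) f x = 0) ->
  (forall E, \sum_(x | fedge x == E) f x = 0) ->
  forall x, ~~ loop_edge (fedge x) -> f x = 0.
Proof.
move=> fv fE x nl.
pose F y : K := oapp f 0 (insub y).
have F_opp E : F (E, false) = - F (E, true).
  apply/eqP; rewrite -addr_eq0 addrC -(fE E); apply/eqP.
  rewrite -(sum_half_edges (fun y => y.1 == E)).
  transitivity (\sum_(E' | E' == E) \sum_b F (E', b)).
    by rewrite big_pred1_eq big_bool.
  by rewrite pair_big /=; apply: eq_big => [[E' b]|[E' b] _] //=; rewrite andbT.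
pose c : {ffun gedge G -> K^o} := [ffun E => F (E, true)].
have cS : c \in solutions (@boundary G) K.
  apply/solutionsP => v; rewrite sum_boundary.
  transitivity (\sum_(y | gend y.1 y.2 == v) F y).
    transitivity (\sum_b \sum_(E | gend E b == v) F (E, b)).
      rewrite big_bool /= -sumrN; congr +%R; apply: eq_bigr => E _; rewrite ffunE ?F_opp //.
    by rewrite pair_big_dep /= (reindex (fun y : gedge G * bool => (y.2, y.1))) //=;
      [apply: eq_big => [[E b]|[E b] _] | exists (fun y => (y.2, y.1)) => -[]].
  rewrite sum_half_edges; case: (boolP (leaf v)) => Lv.
    by rewrite big1 // => y /eqP e; move: (valP y); rewrite e Lv.
  by rewrite -[RHS](fv (exist _ v Lv)); apply: eq_bigl => y; rewrite -val_eqE.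
have := solutions_nonloop nl cS; rewrite ffunE /= => F0.
have : F (val x) = 0.
  by move: F0; case: x nl => [[E [|]] nL] //= _ F0; rewrite F_opp F0 oppr0.
by rewrite /F valK.
Qed.

End Flags.

(** * The incidence system of the curve *)

Lemma base_change_ratr (K : numFieldType) n (u : 'rV[int]_n) :
  map_mx ratr (base_change rat u) = base_change K u.
Proof. by apply/matrixP => i j; rewrite !mxE ratr_int. Qed.

Section Curve.
Variables (n : nat) (G : weighted_graph) (h : immersive_tropical_curve G n).

Lemma direction_neq0 x : direction h x != 0.
Proof.
apply/eqP => e; have := @direction_primitive _ _ h x 2%N 0.
by rewrite e mul0rn => /(_ erefl).
Qed.

(** Both directions are multiples of the difference of the end positions. The factor is found over
    the rationals, where the curve is given, and then carried to [K]. *)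
Lemma direction_parallel (K : numFieldType) (x y : flag G) :
  fedge x = fedge y -> x != y ->
  exists l : K, base_change K (direction h y) = l *: base_change K (direction h x).
Proof.
move=> e ne.
have [l _ el] := @position_realizes _ _ h x y e ne.
have [l' l'0 el'] : exists2 l' : rat, 0 < l' &
    position h (fvertex x) - position h (fvertex y) = l' *: base_change rat (direction h y).
  by apply: (@position_realizes _ _ h y x (esym e)); rewrite eq_sym.
have l'1 : l'^-1 * l' = 1 by rewrite mulVf // gt_eqF.
have exy : base_change rat (direction h y) = (- (l'^-1 * l)) *: base_change rat (direction h x).
  rewrite scaleNr -scalerA -el -scalerN opprB el' scalerA l'1.
  by rewrite scale1r.
exists (ratr (- (l'^-1 * l))).
rewrite -(base_change_ratr K (direction h y)) -(base_change_ratr K (direction h x)).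
by rewrite exy map_mxZ.
Qed.

Definition unknown : finType :=
  (vertex G * 'I_n + gedge G * 'I_n + bounded_edge G)%type.

(* The unknowns are the positions p of the vertices, a vector q_E for each edge
   and a scalar l_E for each bounded edge; the equation of a flag x of E is
   p(x) - q_E + l_E * direction(x) = 0, where the last term only occurs if x is
   the first flag of a bounded edge. So q_E is the position of the second end of
   E, and l_E the length of E. In the transposed system, p, q_E and l_E give the
   vertex, edge and segment conditions of the dual obstruction space. *)
Definition incidence (i : unknown) (j : flag G * 'I_n) : rat :=
  match i with
  | inl (inl vk) => (vk == (fvertex j.1, j.2))%:R
  | inl (inr Ek) => - (Ek == (fedge j.1, j.2))%:R
  | inr E => (bounded_flag E false == j.1)%:R * (direction h j.1 0 j.2)%:~R
  end.

Lemma sum_incidence (K : numFieldType) (x : unknown -> K) y k :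
  \sum_i ratr (incidence i (y, k)) * x i =
  x (inl (inl (fvertex y, k))) - x (inl (inr (fedge y, k)))
  + \sum_E (bounded_flag E false == y)%:R * ((direction h y 0 k)%:~R * x (inr E)).
Proof.
rewrite big_sumType big_sumType /=; congr (_ + _ + _).
- rewrite -[RHS](sum_delta (fvertex y, k) (fun vk => x (inl (inl vk)))).
  by apply: eq_bigr => vk _; rewrite ratr_nat.
- rewrite -[x _](sum_delta (fedge y, k) (fun vk => x (inl (inr vk)))) -sumrN.
  by apply: eq_bigr => vk _; rewrite rmorphN /= ratr_nat mulNr.
- by apply: eq_bigr => E _; rewrite rmorphM /= ratr_nat ratr_int mulrA.
Qed.

Lemma sum_bounded_first (K : pzRingType) (t : bounded_edge G -> K) E s :
  \sum_E' (bounded_flag E' false == bounded_flag E s)%:R * t E' =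
  (~~ s)%:R * t E.
Proof.
case: s; rewrite /= ?mul0r ?mul1r.
  by rewrite big1 // => E' _; rewrite -val_eqE /= xpair_eqE andbF mul0r.
rewrite -[RHS](sum_delta E t); apply: eq_bigr => E' _.
by rewrite -val_eqE /= xpair_eqE eqxx andbT.
Qed.

Lemma sum_bounded_unbounded (K : pzRingType) (t : bounded_edge G -> K) y :
  unbounded (fedge y) -> \sum_E' (bounded_flag E' false == y)%:R * t E' = 0.
Proof.
move=> uy; rewrite big1 // => E _; case: eqP => [e|]; last by rewrite mul0r.
by move: uy; rewrite -e (negPf (valP E)).
Qed.

Lemma transpose_solutionsP (K : numFieldType) (z : {ffun flag G * 'I_n -> K^o}) :
  z \in solutions (fun j i => incidence i j) K <->
  [/\ forall v k, \sum_(y | fvertex y == v) z (y, k) = 0,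
      forall E k, \sum_(y | fedge y == E) z (y, k) = 0 &
      forall E, \sum_k (direction h (bounded_flag E false) 0 k)%:~R
                  * z (bounded_flag E false, k) = 0 :> K].
Proof.
have pick (T : eqType) (g : flag G -> T) t k :
    \sum_j ((t, k) == (g j.1, j.2))%:R * z j = \sum_(y | g y == t) z (y, k) :> K.
  transitivity (\sum_y \sum_k' ((t, k) == (g y, k'))%:R * z (y, k') : K).
    by rewrite pair_bigA; apply: eq_bigr => -[].
  rewrite [RHS]big_mkcond; apply: eq_bigr => y _.
  rewrite -(sum_delta k (fun k' => if g y == t then z (y, k') else 0 : K)).
  apply: eq_bigr => k' _; rewrite xpair_eqE [t == _]eq_sym [k == _]eq_sym.
  by case: (g y == t); rewrite ?mul0r ?mulr0.
have e1 v k : \sum_j ratr (incidence (inl (inl (v, k))) j) * z j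
    = \sum_(y | fvertex y == v) z (y, k) :> K.
  by rewrite -pick; apply: eq_bigr => j _; rewrite /= ratr_nat.
have e2 E k : \sum_j ratr (incidence (inl (inr (E, k))) j) * z j
    = - \sum_(y | fedge y == E) z (y, k) :> K.
  rewrite -pick -sumrN; apply: eq_bigr => j _.
  by rewrite /= rmorphN /= ratr_nat mulNr.
have e3 E : \sum_j ratr (incidence (inr E) j) * z j =
    \sum_k (direction h (bounded_flag E false) 0 k)%:~R * z (bounded_flag E false, k) :> K.
  transitivity (\sum_y (y == bounded_flag E false)%:R *
      \sum_k (direction h y 0 k)%:~R * z (y, k) : K); last first.
    by rewrite (sum_delta _ (fun y => \sum_k (direction h y 0 k)%:~R * z (y, k) : K)).
  under [RHS]eq_bigr do rewrite mulr_sumr.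
  rewrite pair_bigA; apply: eq_bigr => -[y k] _ /=.
  by rewrite rmorphM /= ratr_nat ratr_int eq_sym mulrA.
rewrite solutionsP; split=> [hz | [h1 h2 h3] [[[v k]|[E k]]|E]].
- split=> [v k|E k|E]; [by rewrite -e1 hz | | by rewrite -e3 hz].
  by apply/eqP; rewrite -oppr_eq0 -e2 hz.
- by rewrite e1 h1.
- by rewrite e2 h2 oppr0.
- by rewrite e3 h3.
Qed.

End Curve.

(** * The dual obstruction space as the kernel of the transposed system *)

Section Dual.
Variables (R : realType) (n : nat) (G : weighted_graph).
Variables (h : immersive_tropical_curve G n) (h3 : trivalent G).
Implicit Type f : {ffun flag G -> 'cV[R[i]]_n}.

(** A third flag at this vertex cannot lie in the loop part, since [loop_valence] would then be 3.
    It therefore carries 0, and the vertex condition involves only [x] and [y]. *)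
Lemma uncut_flags_opp f (x y : flag G) :
  (forall v, \sum_(z | fvertex z == v) f z = 0) ->
  (forall z, ~~ loop_edge (fedge z) -> f z = 0) ->
  loop_edge (fedge x) -> loop_edge (fedge y) -> fvertex x = fvertex y ->
  loop_valence (fvertex x) != 3%N -> x != y -> f x = - f y.
Proof.
move=> fv fnl Lx Ly exy val_ne xy; move: (fv (fvertex x)).
rewrite (bigD1 x) //= (bigD1 y) /=; last by rewrite exy eqxx eq_sym.
rewrite addrA big1 ?addr0 => [/eqP|z /andP [/andP [/eqP ez zx] zy]].
  by rewrite addr_eq0 => /eqP.
apply: fnl; apply: contra val_ne => Lz.
rewrite eqn_leq; apply/andP; split.
  rewrite -(h3.2 (fvertex x)) -card_flags_at subset_leq_card //.
  by apply/subsetP => w; rewrite !inE => /andP [].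
have -> : 3%N = #|[set x; y; z]|.
  by rewrite -setUA cardsU1 cards2 !inE negb_or xy eq_sym zx eq_sym zy.
apply: subset_leq_card; apply/subsetP => w; rewrite !inE.
case/orP => [/orP [] |] /eqP ->.
- by rewrite eqxx.
- by rewrite exy eqxx.
- by rewrite ez eqxx.
Qed.

Lemma dual_obstruction_incidence f :
  dual_obstruction h f <->
  [/\ forall v, \sum_(y | fvertex y == v) f y = 0,
      forall E, \sum_(y | fedge y == E) f y = 0 &
      forall E : bounded_edge G,
        base_change R[i] (direction h (bounded_flag E false)) *m f (bounded_flag E false) = 0].
Proof.
split=> [[f_nl f_ann fv fE] | [fv fE f_dir]].
  split=> // E.
    case: (boolP (loop_edge E)) => LE; first exact: fE.
    by rewrite big1 // => y /eqP e; rewrite f_nl // e.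
  case: (boolP (loop_edge (val E))) => LE; last by rewrite f_nl ?mulmx0.
  apply: f_ann => //; apply: memv_span; apply/imageP.
  by exists (bounded_flag E false) => //; rewrite inE; exact: connect0.
(* Each coordinate of [f] is a scalar flow. *)
have f_nl y : ~~ loop_edge (fedge y) -> f y = 0.
  move=> nl; apply/colP => k; rewrite [RHS]mxE.
  apply: (@flow_nonloop G _ (fun y => f y k 0)) nl => [v|E].
    by move/colP/(_ k): (fv v); rewrite summxE mxE.
  by move/colP/(_ k): (fE E); rewrite summxE mxE.
have edge_ann (w : 'rV_n) (x y : flag G) : fedge x = fedge y ->
    w *m f x = 0 -> w *m f y = 0.
  move=> e wx; case: (eqVneq x y) => [<- //|ne].
  by rewrite (edge_flags_opp (fE _) e ne) mulmxN wx oppr0.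
(* The system constrains only the first flag of a bounded edge. The second flag follows because its
   direction is parallel and its value opposite; the only flag of an unbounded edge carries 0. *)
have self_ann x : base_change R[i] (direction h x) *m f x = 0.
  case: (pickP (fun y => (fedge y == fedge x) && (x != y))) => [y /andP [/eqP e ne] | no].
    have [E [s [ex ey]]] := edge_flagsP (esym e) ne.
    case: s ex ey => ex ey; last by rewrite ex f_dir.
    apply: (edge_ann _ y x) => //; rewrite eq_sym in ne.
    have [l ->] := direction_parallel h R[i] e ne.
    by rewrite ey -scalemxAl f_dir scaler0.
  move: (fE (fedge x)); rewrite (bigD1 x) //= big1 ?addr0 => [->|z]; first by rewrite mulmx0.
  by rewrite [z == x]eq_sym (no z).
(* Along a chain of [uncut] edges the values of [f] change only by sign, so a vector killed at one
   edge is killed on the whole segment. *)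
have seg_ann (w : 'rV_n) E E' : same_segment E E' ->
    (forall x, fedge x = E' -> w *m f x = 0) -> forall x, fedge x = E -> w *m f x = 0.
  move=> /connectP [p + ->]; elim: p E => //= E1 p IH E /andP [u up] wE' z ez.
  have wE1 := IH _ up wE'.
  case/existsP: u => x /existsP [y].
  case/and5P => /eqP ex /eqP ey LE LE1 /andP [/eqP exy val_ne].
  apply: (edge_ann _ x); first by rewrite ex.
  case: (eqVneq x y) => [->|ne]; first exact: wE1.
  rewrite (@uncut_flags_opp f x y) // ?ex ?ey //.
  by rewrite mulmxN wE1 ?oppr0.
split=> // y Ly u.
(* The vectors killed by [f y] form a subspace, so it suffices to test the spanning directions of
   the segment. *)
have : (segment_span R h (fedge y) <=
    lker (linfun (mulmxr (f y) : 'rV_n -> 'rV_1)))%VS.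
  apply/span_subvP => _ /imageP [x xy ->]; rewrite memv_ker lfunE /=; apply/eqP.
  apply: (seg_ann _ (fedge y) (fedge x)) => // x' ex'.
  by apply: (edge_ann _ x x').
by move=> /subvP sub /sub; rewrite memv_ker lfunE => /eqP.
Qed.

Lemma dim_dual_obstruction :
  \dim (dual_obstruction_space R h) =
  \dim (solutions (fun j i => incidence h i j) R[i]).
Proof.
pose col (z : {ffun flag G * 'I_n -> R[i]^o}) : {ffun flag G -> 'cV[R[i]]_n} :=
  [ffun y => \col_k z (y, k)].
have colE z y k : col z y k 0 = z (y, k) by rewrite ffunE mxE.
have sum_col (P : pred (flag G)) z :
    \sum_(y | P y) col z y = 0 <-> forall k, \sum_(y | P y) z (y, k) = 0 :> R[i].
  split=> [/colP e k | e].
    move: (e k) => /[1!summxE] /[1!mxE] ek; rewrite -[RHS]ek.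
    by apply: eq_bigr => y _; rewrite colE.
  apply/colP => k; rewrite summxE [RHS]mxE -[RHS](e k).
  by apply: eq_bigr => y _; rewrite colE.
have colP z : z \in solutions (fun j i => incidence h i j) R[i] <->
    dual_obstruction h (col z).
  rewrite dual_obstruction_incidence transpose_solutionsP.
  have dirE E : base_change R[i] (direction h (bounded_flag E false))
        *m col z (bounded_flag E false) = 0 <->
      \sum_k (direction h (bounded_flag E false) 0 k)%:~R
        * z (bounded_flag E false, k) = 0 :> R[i].
    have e : \sum_k (direction h (bounded_flag E false) 0 k)%:~R
        * z (bounded_flag E false, k) =
        (base_change R[i] (direction h (bounded_flag E false))
        *m col z (bounded_flag E false)) 0 0.
      by rewrite mxE; apply: eq_bigr => k _; rewrite mxE colE.
    rewrite e; split=> [-> | e0]; first by rewrite mxE.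
    by apply/matrixP => i j; rewrite !ord1 e0 mxE.
  split=> -[z1 z2 z3]; split=> [v|E|E].
  - by apply/sum_col.
  - by apply/sum_col.
  - by apply/dirE.
  - by apply/sum_col.
  - by apply/sum_col.
  - by apply/dirE.
apply: (dim_bijective_image (f := col)).
- by move=> b u v; apply/ffunP => y; apply/matrixP => i j; rewrite !(ffunE, mxE).
- move=> z _ /ffunP e; apply/ffunP => -[y k].
  by rewrite -colE e !ffunE mxE.
- by move=> z /colP /dual_obstruction_spaceP.
- move=> f /dual_obstruction_spaceP fH; exists [ffun yk => f yk.1 yk.2 0].
    apply/colP; rewrite (_ : col _ = f) //.
    by apply/ffunP => y; apply/matrixP => i j; rewrite !(ffunE, mxE) ord1.
  by apply/ffunP => y; apply/matrixP => i j; rewrite !(ffunE, mxE) ord1.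
Qed.

End Dual.

(** * The parameter space and its translations as the kernel of the system *)

Section Primal.
Variables (R : realType) (n : nat) (G : weighted_graph).
Variable h : immersive_tropical_curve G n.
Implicit Types p q : {ffun vertex G -> 'rV[R]_n}.

(** This is [realizes] without the sign condition on the edge lengths, which makes it a linear
    condition. *)
Definition infinitesimal_deformation p : Prop :=
  forall x y : flag G, fedge x = fedge y -> x != y ->
    exists l : R, p (fvertex y) - p (fvertex x) = l *: base_change R (direction h x).

Definition base_curve : {ffun vertex G -> 'rV[R]_n} :=
  [ffun v => map_mx ratr (position h v)].

Lemma base_curve_realizes : realizes (direction h) base_curve.
Proof.
move=> x y e ne; have [l l0 el] := @position_realizes _ _ h x y e ne.
exists (ratr l); first by rewrite ltr0q.
rewrite !ffunE -(base_change_ratr R (direction h x)) -map_mxZ -el.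
by apply/matrixP => i j; rewrite !mxE rmorphB.
Qed.

Lemma infinitesimal_deformationP p :
  p \in set_span infinitesimal_deformation <-> infinitesimal_deformation p.
Proof.
apply: set_span_subspace => [x y _ _|b q q' hq hq' x y e ne].
  by exists 0; rewrite !ffunE subrr scale0r.
have [l el] := hq x y e ne; have [l' el'] := hq' x y e ne.
exists (b * l + l').
by rewrite !ffunE scalerDl -scalerA -el -el' scalerBr opprD addrACA.
Qed.

Lemma add_scale_ffunE (t : R) p q v : (t *: p + q) v = t *: p v + q v.
Proof. by rewrite !ffunE. Qed.

(** In [t *: base_curve + p] an edge has length [t * l0 + l] with [l0] positive, which is positive
    for large [t]. There are finitely many edges, so one [t] serves for all. *)
Lemma realizes_far p : infinitesimal_deformation p ->
  exists2 t : R, 0 < t & realizes (direction h) (t *: base_curve + p).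
Proof.
move=> pD.
have : forall xy : flag G * flag G, exists t0 : R, 0 <= t0 /\
    (fedge xy.1 = fedge xy.2 -> xy.1 != xy.2 -> forall t, t0 <= t ->
     exists2 l : R, 0 < l & (t *: base_curve + p) (fvertex xy.2)
       - (t *: base_curve + p) (fvertex xy.1) = l *: base_change R (direction h xy.1)).
  move=> [x y] /=.
  case: (boolP ((fedge x == fedge y) && (x != y))) => [/andP [/eqP e ne]|no];
    last first.
    by exists 0; split=> // e ne; move: no; rewrite e eqxx ne.
  have [l0 l0_gt0 el0] := base_curve_realizes e ne.
  have [l el] := pD x y e ne.
  (* From this threshold on, [t * l0] is at least [|l| + 1], so the new length is at least 1. *)
  exists ((`|l| + 1) / l0); split=> [|_ _ t let0].
    by rewrite divr_ge0 ?ltW // ltr_wpDl.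
  exists (t * l0 + l); last first.
    by rewrite !add_scale_ffunE scalerDl -scalerA -el0 -el scalerBr opprD addrACA.
  move: let0; rewrite ler_pdivrMr // => ht.
  have := ler_norm (- l); rewrite normrN => hl; lra.
case/fin_all_exists => t0 ht0.
have t0_ge0 xy : 0 <= t0 xy by case: (ht0 xy).
(* The thresholds are nonnegative, so their sum dominates each of them; the summand 1 keeps [t]
   positive even if all of them are 0. *)
exists (1 + \sum_xy t0 xy).
  by rewrite ltr_wpDr // sumr_ge0.
move=> x y e ne; apply: (ht0 (x, y)).2 => //.
rewrite (bigD1 (x, y)) //= addrCA lerDl addr_ge0 // sumr_ge0 // => xy _.
Qed.

Lemma affine_dim_parameter_space :
  affine_dim (parameter_space R h) = \dim (set_span infinitesimal_deformation).
Proof.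
rewrite /affine_dim; congr (\dim _); apply/eqP; rewrite eqEsubv.
apply/andP; split; apply: set_span_min => z.
  move=> [p [q [pS qS ->]]]; apply/infinitesimal_deformationP => x y e ne.
  have [l _ el] := pS x y e ne; have [l' _ el'] := qS x y e ne.
  exists (l - l'); rewrite !ffunE scalerBl -el -el'.
  by apply/rowP => k; rewrite !mxE; ring.
move=> zD; have [t t0 tz] := realizes_far zD.
(* [z] is the difference of two genuine curves of the given type. *)
apply: sub_set_span; exists (t *: base_curve + z), (t *: base_curve); split=> //.
  move=> x y e ne; have [l l0 el] := base_curve_realizes e ne.
  exists (t * l); first exact: mulr_gt0.
  have scE v : (t *: base_curve) v = t *: base_curve v by rewrite [LHS]ffunE.
  by rewrite !scE -scalerBr el scalerA.
by rewrite addrAC subrr add0r.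
Qed.

Lemma unbounded_flag (v0 : vertex G) (E : gedge G) : unbounded E ->
  exists y : flag G, fedge y = E.
Proof.
case/existsP => s Ls.
by exists (exist _ (E, ~~ s) (unbounded_one_leaf v0 Ls)).
Qed.

Lemma bounded_unbounded_edge E :
  unbounded E \/ exists B : bounded_edge G, val B = E.
Proof.
case: (boolP (unbounded E)) => bE; first by left.
by right; exists (exist _ E bE).
Qed.

(** A solution is determined by its vertex positions: the equations without a length term fix each
    [q_E], and then a nonzero direction fixes each [l_E]. Here [v0] guarantees that every unbounded
    edge has a flag. *)
Lemma dim_infinitesimal_deformation (v0 : vertex G) :
  \dim (set_span infinitesimal_deformation) = \dim (solutions (incidence h) R).
Proof.
pose pos (x : {ffun unknown n G -> R^o}) : {ffun vertex G -> 'rV[R]_n} :=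
  [ffun v => \row_k x (inl (inl (v, k)))].
have posE x v k : pos x v 0 k = x (inl (inl (v, k))) by rewrite ffunE mxE.
have flag_bounded (y : flag G) : ~~ unbounded (fedge y) -> exists B s, y = bounded_flag B s.
  move=> bE; exists (Sub (fedge y) bE : bounded_edge G), (val y).2; apply: val_inj.
  by case: y bE => [[]].
have solP x : x \in solutions (incidence h) R <->
    (forall (E : bounded_edge G) s k,
       x (inl (inl (fvertex (bounded_flag E s), k))) - x (inl (inr (val E, k)))
       + (~~ s)%:R * ((direction h (bounded_flag E s) 0 k)%:~R * x (inr E)) = 0) /\
    (forall y k, unbounded (fedge y) ->
       x (inl (inl (fvertex y, k))) = x (inl (inr (fedge y, k)))).
  rewrite solutionsP; split=> [xS | [xb xu] [y k]].
    split=> [E s k|y k uy]; have := xS (_, k).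
      move/(_ (bounded_flag E s)); rewrite sum_incidence.
      rewrite (eq_bigr (fun E' => (bounded_flag E' false == bounded_flag E s)%:R *
        ((direction h (bounded_flag E s) 0 k)%:~R * x (inr E')))) //.
      by rewrite sum_bounded_first.
    move/(_ y); rewrite sum_incidence sum_bounded_unbounded // addr0.
    by move/eqP; rewrite subr_eq0 => /eqP.
  rewrite sum_incidence; case: (boolP (unbounded (fedge y))) => uy.
    by rewrite sum_bounded_unbounded // xu // subrr addr0.
  have [E [s ->]] := flag_bounded y uy.
  by rewrite sum_bounded_first xb.
apply: (dim_bijective_image (f := pos)).
- by move=> b u v; apply/ffunP => y; apply/matrixP => i j; rewrite !(ffunE, mxE).
- move=> x /solP [xb xu] /ffunP x0.
  have xp v k : x (inl (inl (v, k))) = 0 by rewrite -posE x0 ffunE mxE.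
  have xq E k : x (inl (inr (E, k))) = 0.
    have [uE|[B <-]] := bounded_unbounded_edge E.
      by have [y ey] := unbounded_flag v0 uE; rewrite -ey -xu ?xp // ey.
    by have := xb B true k; rewrite xp sub0r mul0r addr0 => /eqP; rewrite oppr_eq0 => /eqP.
  apply/ffunP => -[[[v k]|[E k]]|E]; rewrite [RHS]ffunE ?xp ?xq //.
  have /rV0Pn [k uk] := direction_neq0 h (bounded_flag E false).
  have := xb E false k; rewrite xp xq subrr add0r mul1r => /eqP.
  by rewrite mulf_eq0 intr_eq0 (negPf uk) => /eqP.
- move=> x /solP [xb _]; apply/infinitesimal_deformationP => y z e ne.
  have [E [s [-> ->]]] := edge_flagsP e ne.
  have ex : pos x (fvertex (bounded_flag E true)) - pos x (fvertex (bounded_flag E false))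
      = x (inr E) *: base_change R (direction h (bounded_flag E false)).
    apply/rowP => k; rewrite !mxE; have := xb E false k; have := xb E true k.
    rewrite !ffunE !mxE /= mul0r addr0 mul1r mulrC => e1 e2; lra.
  (* Seen from the second end the difference changes sign, and the direction is rewritten in terms
     of that of the second flag. *)
  case: s => /=; last by exists (x (inr E)).
  have neqE : bounded_flag E true != bounded_flag E false.
    by rewrite -val_eqE /= xpair_eqE andbF.
  have [l el] := @direction_parallel _ _ h R
    (bounded_flag E true) (bounded_flag E false) erefl neqE.
  by exists (- (x (inr E) * l)); rewrite -opprB ex el scalerA scaleNr.
move=> p /infinitesimal_deformationP pD.
have /fin_all_exists [l hl] : forall E : bounded_edge G, exists l : R,
    p (fvertex (bounded_flag E true)) - p (fvertex (bounded_flag E false))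
      = l *: base_change R (direction h (bounded_flag E false)).
  by move=> E; apply: pD; rewrite // -val_eqE /= xpair_eqE andbF.
(* [q] is the position of the second end of a bounded edge, and of the only vertex of an unbounded
   one. *)
have /fin_all_exists [q hq] : forall E : gedge G, exists q : 'rV[R]_n,
    (forall B : bounded_edge G, val B = E -> q = p (fvertex (bounded_flag B true))) /\
    (unbounded E -> forall y, fedge y = E -> q = p (fvertex y)).
  move=> E; have [uE|[B eB]] := bounded_unbounded_edge E.
    have [y ey] := unbounded_flag v0 uE; exists (p (fvertex y)); split.
      by move=> B eB; move: (valP B); rewrite eB uE.
    move=> _ z ez; case: (eqVneq y z) => [-> //|ne].
    have [B [s [eyB _]]] := edge_flagsP (etrans ey (esym ez)) ne.
    by move: (valP B); rewrite -[val B]/(fedge (bounded_flag B s)) -eyB ey uE.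
  exists (p (fvertex (bounded_flag B true))); split=> [B' eB'|].
    by rewrite (_ : B' = B) //; apply: val_inj; rewrite eB' eB.
  by move=> uE; move: (valP B); rewrite eB uE.
exists [ffun i => match i with
  | inl (inl (v, k)) => p v 0 k
  | inl (inr (E, k)) => q E 0 k
  | inr E => l E
  end]; last first.
  by apply/ffunP => v; apply/rowP => k; rewrite !(ffunE, mxE).
apply/solP; split=> [E s k|y k uy]; rewrite !ffunE; last first.
  by rewrite ((hq (fedge y)).2 uy y erefl).
rewrite ((hq (val E)).1 E erefl); case: s => /=; first by rewrite subrr mul0r addr0.
move/rowP/(_ k): (hl E); rewrite !mxE mul1r mulrC => e; lra.
Qed.

End Primal.

(** * The dimension formula *)

Theorem theorem45 (R : realType) (n : nat) (G : weighted_graph)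
    (h : immersive_tropical_curve G n) (h3 : trivalent G) :
  (affine_dim (parameter_space R h))%:Z
  = (n%:Z - 3) * (1 - (genus G)%:Z) + (num_unbounded G)%:Z
    + (\dim (dual_obstruction_space R h))%:Z.
Proof.
have /card_gt0P [v0 _] := h3.1.
rewrite affine_dim_parameter_space (dim_infinitesimal_deformation R h v0).
rewrite (dim_dual_obstruction R h h3).
have := dim_solutions_tr (incidence h) R R[i].
rewrite !card_sum !card_prod card_ord.
have := euler_characteristic (val v0).
have := card_flags h3; have := card_half_edges v0.
have := card_vertices v0; have := card_edges G.
(* With [V] vertices of the curve, [B] bounded and [e] unbounded edges, the kernel dimensions differ
   by [n * (B + e - 2 * V) + B]. The counts give [B + e - 2 * V = 1 - g] and
   [B = 3 * (g - 1) + e]. *)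
move: #|_| #|_| #|_| #|_| #|_| => a b c d e.
nia.
Qed.
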